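(* Let $G$ be a graph with a perfect matching. Then $G$ is Egerváry if and only if $G$ does not contain an even subdivision of $T$ as a nice subgraph.
   Context: Graphs are finite and simple. A graph is Egerváry if it has a perfect matching but does not contain a spanning subgraph whose components are independent edges (components isomorphic to $K_2$, possibly none) together with at least one odd cycle. $T$ is the graph on 6 vertices consisting of two vertex-disjoint triangles together with a single edge joining a vertex of one to a vertex of the other. An even subdivision of a graph is obtained by subdividing each edge an even number (possibly zero) of times, i.e. replacing each edge by a path of odd length. A subgraph $H$ of a graph $G$ with a perfect matching is nice if $G-V(H)$ has a perfect matching (the null graph counts as having one). *)

(* Defs.v *)
From mathcomp Require Import all_boot.

Set Implicit Arguments.
Unset Strict Implicit.
Unset Printing Implicit Defensive.

Record sgraph := SGraph {
  svertex :> finType;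
  sedge : rel svertex;
  sedge_sym : symmetric sedge;
  sedge_irrefl : irreflexive sedge
}.

Notation "x -- y" := (sedge x y) (at level 30).

Record sgraph_iso (G H : sgraph) (f : G -> H) : Prop := SGraphIso {
  iso_bij : bijective f;
  iso_edge : forall x y, (f x -- f y) = (x -- y)
}.

Definition isomorphic (G H : sgraph) : Prop := exists f : G -> H, sgraph_iso f.

Definition induced_rel (G : sgraph) (A : {set G}) : rel {x : G | x \in A} :=
  fun x y => val x -- val y.

Lemma induced_sym (G : sgraph) (A : {set G}) : symmetric (@induced_rel G A).
Proof. by move=> x y; apply: sedge_sym. Qed.

Lemma induced_irrefl (G : sgraph) (A : {set G}) : irreflexive (@induced_rel G A).
Proof. by move=> x; apply: sedge_irrefl. Qed.

Definition induced (G : sgraph) (A : {set G}) : sgraph :=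
  SGraph (@induced_sym G A) (@induced_irrefl G A).

Record subgraph (G : sgraph) := Subgraph {
  sub_vset : {set G};
  sub_edge : rel G;
  sub_edge_sym : symmetric sub_edge;
  sub_edgeP : forall x y,
    sub_edge x y -> [/\ x \in sub_vset, y \in sub_vset & x -- y]
}.

Definition subgraph_rel (G : sgraph) (H : subgraph G) :
    rel {x : G | x \in sub_vset H} :=
  fun x y => sub_edge H (val x) (val y).

Lemma subgraph_rel_sym (G : sgraph) (H : subgraph G) :
  symmetric (@subgraph_rel G H).
Proof. by move=> x y; apply: sub_edge_sym. Qed.

Lemma subgraph_rel_irrefl (G : sgraph) (H : subgraph G) :
  irreflexive (@subgraph_rel G H).
Proof.
by move=> x; apply/negP => /sub_edgeP[_ _]; rewrite sedge_irrefl.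
Qed.

Definition graph_of_subgraph (G : sgraph) (H : subgraph G) : sgraph :=
  SGraph (@subgraph_rel_sym G H) (@subgraph_rel_irrefl G H).

Coercion graph_of_subgraph : subgraph >-> sgraph.

Definition spanning (G : sgraph) (H : subgraph G) : Prop :=
  sub_vset H = [set: G].

Definition edges (G : sgraph) : {set {set G}} :=
  [set [set p.1; p.2] | p : G * G & p.1 -- p.2].

Definition perfect_matching (G : sgraph) (M : {set {set G}}) : Prop :=
  [/\ M \subset edges G, trivIset M & cover M = [set: G]].

Definition has_perfect_matching (G : sgraph) : Prop :=
  exists M : {set {set G}}, perfect_matching M.

Definition nice (G : sgraph) (H : subgraph G) : Prop :=
  has_perfect_matching (induced (~: sub_vset H)).

Definition components (G : sgraph) : {set {set G}} :=
  equivalence_partition (connect (@sedge G)) [set: G].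

Lemma neq_sym (T : eqType) : symmetric (fun x y : T => x != y).
Proof. by move=> x y; rewrite eq_sym. Qed.

Lemma neq_irrefl (T : eqType) : irreflexive (fun x y : T => x != y).
Proof. by move=> x; rewrite eqxx. Qed.

Definition complete_graph (n : nat) : sgraph :=
  SGraph (@neq_sym 'I_n) (@neq_irrefl 'I_n).

(* [ordS i] is the successor of [i] modulo [n]; for [n >= 3] this is the cycle
   of length [n]. *)
Definition cycle_rel (n : nat) : rel 'I_n :=
  fun i j => (i != j) && ((j == ordS i) || (i == ordS j)).

Lemma cycle_rel_sym (n : nat) : symmetric (@cycle_rel n).
Proof. by move=> i j; rewrite /cycle_rel eq_sym orbC. Qed.

Lemma cycle_rel_irrefl (n : nat) : irreflexive (@cycle_rel n).
Proof. by move=> i; rewrite /cycle_rel eqxx. Qed.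

Definition cycle_graph (n : nat) : sgraph :=
  SGraph (@cycle_rel_sym n) (@cycle_rel_irrefl n).

Definition is_odd_cycle (G : sgraph) : Prop :=
  exists n : nat, [/\ 3 <= n, odd n & isomorphic G (cycle_graph n)].

Definition edges_and_odd_cycles (H : sgraph) : Prop :=
  (forall C, C \in components H ->
     isomorphic (induced C) (complete_graph 2) \/ is_odd_cycle (induced C)) /\
  (exists2 C, C \in components H & is_odd_cycle (induced C)).

Definition egervary (G : sgraph) : Prop :=
  has_perfect_matching G /\
  ~ exists H : subgraph G, spanning H /\ edges_and_odd_cycles H.

(* The vertex [(b, i)] is the [i]-th vertex of the triangle number [b]; the two
   triangles are joined by the edge between [(false, 0)] and [(true, 0)]. *)
Definition T_rel : rel (bool * 'I_3) :=
  fun x y => if x.1 == y.1 then x.2 != y.2 else (x.2 == ord0) && (y.2 == ord0).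

Lemma T_rel_sym : symmetric T_rel.
Proof.
by move=> x y; rewrite /T_rel eq_sym [x.2 == y.2]eq_sym andbC.
Qed.

Lemma T_rel_irrefl : irreflexive T_rel.
Proof. by move=> x; rewrite /T_rel !eqxx. Qed.

Definition T_graph : sgraph := SGraph T_rel_sym T_rel_irrefl.

(* [H] arises from [J] by replacing each edge [u -- v] with a path of odd
   length from [f u] to [f v], whose internal vertices are listed, in this
   order, by [P u v]; an even number of internal vertices means odd length. The
   values of [P] at pairs of non-adjacent vertices are irrelevant. *)
Record is_even_subdivision (J H : sgraph)
    (f : J -> H) (P : J -> J -> seq H) : Prop := IsEvenSubdivision {
  esub_inj : injective f;
  esub_rev : forall u v, u -- v -> P v u = rev (P u v);
  esub_uniq : forall u v, u -- v -> uniq (P u v);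
  esub_even : forall u v, u -- v -> ~~ odd (size (P u v));
  esub_internal : forall u v w, u -- v -> f w \notin P u v;
  esub_disjoint : forall u v u' v' x, u -- v -> u' -- v' ->
    x \in P u v -> x \in P u' v' -> [set u; v] = [set u'; v'];
  esub_vertex : forall x,
    (exists u, x = f u) \/ (exists u v, u -- v /\ x \in P u v);
  esub_edge : forall x y, x -- y <->
    exists u v, u -- v /\ infix [:: x; y] (f u :: rcons (P u v) (f v))
}.

Definition even_subdivision (J H : sgraph) : Prop :=
  exists (f : J -> H) (P : J -> J -> seq H), is_even_subdivision f P.

(* Main.v *)
Require Import Defs.
From mathcomp Require Import all_boot zify.

(** Call two disjoint odd cycles joined by a path with an even number of
internal vertices a dumbbell; the dumbbells are exactly the even subdivisions
of T ([dumbbell_subdivision], [subdivision_dumbbell]).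

If a dumbbell is nice, then its two cycles, a perfect matching of the interior
of its path, and a perfect matching of the rest of the graph form a spanning
subgraph of independent edges and odd cycles; so the graph is not Egervary.

Conversely, let [m] be a perfect matching, and let [t] be the matching part of
a spanning subgraph with odd cycles covering the set [D]. Starting from a
vertex of [D], follow alternately edges of [m] and of [t] until [D] is met
again. These walks pair off the vertices of [D], hence some walk leads from an
odd cycle [O] to another one [O'] ([alt_path_exists]), and [O], [O'] and the
walk make a dumbbell. If [O] and [O'] are the only odd cycles, then [t] matches
the rest of the graph, and the dumbbell is nice. Otherwise the dumbbell itself
has a perfect matching (the path with both ends, and each cycle minus one
vertex, have evenly many vertices), so that [O] and [O'] may be turned into
edges, which leaves fewer odd cycles but still at least one; induction on the
size of [D] finishes the argument ([nice_dumbbell_exists]).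

Spanning subgraphs of edges and odd cycles are handled as permutations [s] of
the vertices that move each vertex along an edge and whose orbits have size 2
or odd size ([odd_cover], [odd_cover_of_spanning], [spanning_of_odd_cover]). *)

Set Implicit Arguments.
Unset Strict Implicit.
Unset Printing Implicit Defensive.

(** * Matchings as fixed-point-free involutions *)

Definition matchable (G : sgraph) (A : {set G}) : Prop :=
  exists f : G -> G, {in A, forall x, [/\ f x \in A, f (f x) = x & x -- f x]}.

Lemma has_perfect_matchingP (G : sgraph) :
  has_perfect_matching G <-> matchable [set: G].
Proof.
split=> [[M [sME tM cM]]|[f Hf]].
  have ex_mate x : exists y, x -- y /\ [set x; y] \in M.
    have xM : x \in cover M by rewrite cM.
    have /imsetP[[a b]] := subsetP sME _ (pblock_mem xM).
    rewrite inE /= => ab E.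
    have := mem_pblock M x; rewrite xM E !inE.
    have MM := pblock_mem xM; rewrite E in MM.
    case/orP=> /eqP ->; first by exists b.
    by exists a; rewrite sedge_sym setUC.
  have [f Hf] := fin_all_exists ex_mate.
  exists f => x _; have [e1 M1] := Hf x; have [_ M2] := Hf (f x).
  rewrite inE; split=> //.
  have E : [set x; f x] = [set f x; f (f x)].
    by rewrite -(def_pblock tM M1 (set22 _ _)) (def_pblock tM M2 (set21 _ _)).
  have : x \in [set f x; f (f x)] by rewrite -E set21.
  rewrite !inE => /orP[] /eqP // E'.
  by move: e1; rewrite -E' sedge_irrefl.
have fK x : f (f x) = x by have [] := Hf x (in_setT x).
have fe x : x -- f x by have [] := Hf x (in_setT x).
exists [set [set x; f x] | x in [set: G]]; split.
- apply/subsetP=> A /imsetP[x _ ->]; apply/imsetP.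
  by exists (x, f x); rewrite ?inE.
- apply/trivIsetP=> A B /imsetP[x _ ->] /imsetP[y _ ->].
  apply: contraR => /pred0Pn[z /=]; rewrite !inE => /andP[].
  case/orP=> /eqP -> /orP[] /eqP E; first by rewrite E.
  + by rewrite E fK setUC.
  + by rewrite -E fK setUC.
  + by rewrite -[x]fK E fK.
- apply/setP=> x; rewrite inE; apply/bigcupP.
  by exists [set x; f x]; rewrite ?set21 //; apply: imset_f.
Qed.

Lemma matchable_induced (G : sgraph) (A : {set G}) :
  has_perfect_matching (induced A) <-> matchable A.
Proof.
rewrite has_perfect_matchingP; split=> [[f Hf]|[f Hf]].
  exists (fun x => if insub x is Some u then val (f u) else x) => x xA.
  rewrite (insubT (fun x => x \in A) xA) /=.
  have [_ fK fe] := Hf (Sub x xA) (in_setT _).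
  split; [exact: valP | | exact: fe].
  by rewrite valK fK.
have fA (u : induced A) : f (val u) \in A by have [] := Hf _ (valP u).
exists (fun u => Sub (f (val u)) (fA u)) => u _.
have [_ fK fe] := Hf _ (valP u).
by rewrite inE; split=> //; apply: val_inj.
Qed.

Section Matchable.
Variable G : sgraph.
Implicit Types (A B : {set G}) (p : seq G).

Lemma matchable0 : matchable (set0 : {set G}).
Proof. by exists id => x; rewrite inE. Qed.

Lemma matchableU A B :
  [disjoint A & B] -> matchable A -> matchable B -> matchable (A :|: B).
Proof.
move=> dAB [f Hf] [g Hg]; exists (fun x => if x \in A then f x else g x) => x.
rewrite !inE; case: ifP => [xA _|xA /= xB].
  by have [fA fK fe] := Hf x xA; rewrite fA.
have [gB gK ge] := Hg x xB.
have gA : g x \in A = false by apply/negbTE; rewrite (disjointFl dAB).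
by rewrite gA gB.
Qed.

Lemma matchable_edge (x y : G) : x -- y -> matchable [set x; y].
Proof.
move=> xy; have nxy : y == x = false.
  by apply/eqP => E; move: xy; rewrite E sedge_irrefl.
exists (fun z => if z == x then y else x) => z; rewrite !inE.
case/orP=> /eqP ->; rewrite ?nxy /= ?eqxx ?nxy ?orbT; split=> //.
by rewrite sedge_sym.
Qed.

(** The edges joining positions 0 and 1, 2 and 3, and so on, form the matching. *)
Lemma matchable_sorted p :
  uniq p -> ~~ odd (size p) -> sorted (@sedge G) p ->
  matchable [set x in p].
Proof.
have [n] := ubnP (size p); elim: n p => // n IHn [|x [|y p]] //= sz.
  by move=> _ _ _; rewrite set_nil; exact: matchable0.
rewrite !inE !negb_or negbK => /and3P[/andP[xy xp] yp up] op /andP[exy pp].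
have -> : [set z in x :: y :: p] = [set x; y] :|: [set z in p].
  by apply/setP=> z; rewrite !inE orbA.
apply: matchableU (matchable_edge exy) (IHn p _ up op (path_sorted pp)); last first.
  by lia.
rewrite disjoint_subset; apply/subsetP=> z; rewrite !inE.
by case/orP=> /eqP ->.
Qed.

Lemma matchable_even A : matchable A -> ~~ odd #|A|.
Proof.
have [n] := ubnP #|A|; elim: n A => // n IHn A sA [f Hf].
have [->|[x xA]] := set_0Vmem A; first by rewrite cards0.
have [fA fK fe] := Hf x xA.
have nfx : f x != x by apply/eqP => E; move: fe; rewrite E sedge_irrefl.
have cA := cardsD1 x A; have cA' := cardsD1 (f x) (A :\ x).
rewrite xA in cA; rewrite !inE nfx fA in cA'.
have : ~~ odd #|A :\ x :\ f x|.
  apply: IHn; first by lia.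
  exists f => y; rewrite !inE => /and3P[y1 y2 yA].
  have [fyA fyK fye] := Hf y yA; rewrite fyA; split=> //.
  rewrite andbT; apply/andP; split; apply/eqP=> E.
    by move: y2; rewrite -fyK E fK eqxx.
  by move: y1; rewrite -fyK E eqxx.
by rewrite cA cA' /= !negbK.
Qed.

End Matchable.

(** * Alternating paths between odd cycles *)

Section AlternatingPath.
Variables (G : sgraph) (m t : G -> G) (D : {set G}).
Hypothesis mK : involutive m.
Hypothesis m_edge : forall x, x -- m x.
Hypothesis tP : {in ~: D, forall x, [/\ t x \in ~: D, t (t x) = x & x -- t x]}.

(** The matching [t] only lives outside [D]; a vertex of [D] has a single
neighbour under this relation, which is why a simple path cannot cross [D]. *)
Definition alt_step : rel G :=
  fun x y => (y == m x) || ((x \notin D) && (y == t x)).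

(** On a simple path two consecutive steps cannot both use [m], nor both use
[t], as these are involutions. The first step uses [m]: either [x] is in [D],
where no step along [t] starts, or, in the inductive case, [t x] is the vertex
that the path comes from. The last step uses [m] as well, since [t] never
enters [D]. Thus the interior is a union of pairs [y], [t y]. *)
Lemma alt_path_alternates x p : path alt_step x p -> uniq (x :: p) ->
    (x \in D) || (t x \notin p) -> p != [::] -> last x p \in D ->
  exists r y, [/\ p = rcons r y, ~~ odd (size r), path (@sedge G) x p
    & {in r, forall z, z \notin D /\ t z \in r}].
Proof.
have [n] := ubnP (size p); elim: n x p => // n IHn x [|y q] //= sz.
move=> /andP[xy pq] /and3P[xyq yq uq] xt _ lD.
have {xt} Ey : y = m x.
  case/orP: xy => [/eqP //|/andP[/negbTE xD /eqP E]].
  by move: xt; rewrite xD E inE eqxx.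
case: q sz pq xyq yq uq lD => [|z q] /= sz.
  by move=> *; exists [::], y; split=> //=; rewrite Ey m_edge.
move=> /andP[yz pq] xyzq yzq /andP[zq uq] lD.
have {yz} [yD Ez] : y \notin D /\ z = t y.
  case/orP: yz => [/eqP E|/andP[? /eqP //]].
  by move: xyzq; rewrite E Ey mK !inE eqxx orbT.
have [tyD tyK ty] : [/\ t y \in ~: D, t (t y) = y & y -- t y].
  by apply: tP; rewrite inE.
move: tyD; rewrite -Ez inE => zD.
have q0 : q != [::] by apply: contraTneq lD => ->.
have [|||r [w [Eq odr pzq rP]]] := IHn z q _ pq _ _ q0 lD.
- by lia.
- by rewrite /= zq.
- by rewrite Ez tyK; move: yzq; rewrite inE negb_or => /andP[_ ->]; rewrite orbT.
exists [:: y, z & r], w; split.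
- by rewrite Eq.
- by rewrite /= negbK.
- by rewrite Ey m_edge -Ey Ez ty -Ez.
move=> u; rewrite !inE => /or3P[/eqP->|/eqP->|/rP[uD tur]].
- by rewrite yD Ez eqxx orbT.
- by rewrite zD Ez tyK eqxx.
- by rewrite uD tur !orbT.
Qed.

(** If there were no such path, the set [K] of all vertices reachable from [O]
would meet [D] exactly in [O]. But [K] is even, being matched by [m], and its part outside
[D] is even, being matched by [t], whereas [O] is odd. *)
Lemma alt_path_exists (O : {set G}) : O \subset D -> odd #|O| ->
  exists x y r, [/\ x \in O, y \in D :\: O, uniq (x :: rcons r y),
    ~~ odd (size r) & path (@sedge G) x (rcons r y)] /\
    {in r, forall z, z \notin D /\ t z \in r}.
Proof.
move=> OD oO.
pose K := [set y | [exists x in O, connect alt_step x y]].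
have OK : O \subset K.
  by apply/subsetP=> x xO; rewrite inE; apply/existsP; exists x; rewrite xO connect0.
have Kstep x y : x \in K -> alt_step x y -> y \in K.
  rewrite !inE => /existsP[z /andP[zO zx]] xy; apply/existsP; exists z.
  by rewrite zO (connect_trans zx) ?connect1.
have evK : ~~ odd #|K|.
  apply: matchable_even; exists m => x xK; split=> //.
  by apply: Kstep xK _; rewrite /alt_step eqxx.
have evKD : ~~ odd #|K :\: D|.
  apply: matchable_even; exists t => x /setDP[xK xD].
  have [|] := tP (_ : x \in ~: D); first by rewrite inE.
  move=> txD txK tx; split=> //; rewrite !inE in txD *; rewrite txD.
  have := Kstep x (t x) xK; rewrite /alt_step xD eqxx orbT => /(_ isT).
  by rewrite inE.
have /set0Pn[y] : (K :&: D) :\: O != set0.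
  apply/negP => /eqP E.
  have E' : K :&: D = O.
    by apply/eqP; rewrite eqEsubset -setD_eq0 E eqxx subsetI OK.
  by move: evK; rewrite -(cardsID D K) E' oddD oO (negbTE evKD).
case/setDP=> /setIP[yK yD] yO.
move: yK; rewrite inE => /existsP[x /andP[xO /connectP[p0 xp0 Ey]]].
move: Ey; case/shortenP: xp0 => p xp up _ Ey.
have p0' : p != [::] by apply: contraNneq yO => p0'; rewrite Ey p0'.
have xD := subsetP OD x xO.
have lD : last x p \in D by rewrite -Ey.
have := alt_path_alternates xp up _ p0' lD; rewrite xD => -[//|r [w [Ep odr xpr rP]]].
rewrite Ep last_rcons in Ey up xpr; exists x, w, r.
by split; [split; rewrite // inE -Ey yO | ].
Qed.

End AlternatingPath.

(** * Nice dumbbells from odd cycles *)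

(** The two cycles are listed from the attachment points [x1], [x2] of the
joining path, whose interior is [r]. *)
Record dumbbell (G : sgraph) (x1 : G) (p1 : seq G) (x2 : G) (p2 r : seq G) :
    Prop := Dumbbell {
  dumbbell_uniq : uniq ((x1 :: p1) ++ (x2 :: p2) ++ r);
  dumbbell_cycle1 : cycle (@sedge G) (x1 :: p1);
  dumbbell_cycle2 : cycle (@sedge G) (x2 :: p2);
  dumbbell_even1 : ~~ odd (size p1);
  dumbbell_even2 : ~~ odd (size p2);
  dumbbell_even : ~~ odd (size r);
  dumbbell_path : path (@sedge G) x1 (rcons r x2)
}.

Definition dumbbell_set (G : sgraph) (x1 : G) (p1 : seq G) (x2 : G) (p2 r : seq G) :
  {set G} := [set x in (x1 :: p1) ++ (x2 :: p2) ++ r].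

Section Reduction.
Variables (G : sgraph) (m s : G -> G).
Hypothesis mK : involutive m.
Hypothesis m_edge : forall x, x -- m x.
Hypothesis s_inj : injective s.

Lemma orbit_cons x : orbit s x = x :: behead (orbit s x).
Proof. by rewrite /orbit; case: (order s x) (order_gt0 s x). Qed.

Lemma orbit_edge_cycle (D : {set G}) x :
    {in D, forall x, [/\ s x \in D, x -- s x & odd (order s x)]} -> x \in D ->
  {subset orbit s x <= D} /\ cycle (@sedge G) (orbit s x).
Proof.
move=> sD xD.
have oD y : y \in orbit s x -> y \in D.
  rewrite -fconnect_orbit => /iter_findex <-.
  by elim: (findex _ _ _) => //= n /sD[].
split=> //; apply: cycle_from_next => [|y yx]; first exact: orbit_uniq.
by rewrite (nextE (cycle_orbit s_inj x)) //; have [] := sD y (oD y yx).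
Qed.

(** Induction on the size of [D], the union of the odd cycles of [s]. An
alternating path out of one cycle reaches another one, which gives a dumbbell
with vertex set [B]. Either [B] contains [D] and the matching of the complement
of [D] restricts to the complement of [B], or [B] is matched internally and
[D :\: B] takes the role of [D]. *)
Lemma nice_dumbbell_exists (D : {set G}) : D != set0 ->
    {in D, forall x, [/\ s x \in D, x -- s x & odd (order s x)]} ->
    @matchable G (~: D) ->
  exists x1 p1 x2 p2 r, dumbbell x1 p1 x2 p2 r /\
    @matchable G (~: dumbbell_set x1 p1 x2 p2 r).
Proof.
have [n] := ubnP #|D|; elim: n D => // n IHn D szD /set0Pn[x0 x0D] sD mD.
have [t tP] := mD.
have [o0D _] := orbit_edge_cycle sD x0D.
have oddO : odd #|[set z in orbit s x0]|.
  rewrite cardsE (card_uniqP (orbit_uniq s x0)) size_orbit.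
  by have [] := sD x0 x0D.
have OD : [set z in orbit s x0] \subset D.
  by apply/subsetP=> z; rewrite inE; apply: o0D.
have [x1 [x2 [r [[]]]]] := alt_path_exists mK m_edge tP OD oddO.
rewrite !inE => x1O /andP[x2O x2D] ur er pr rP.
have x1D := o0D _ x1O.
have x2O1 : x2 \notin orbit s x1.
  rewrite -fconnect_orbit; apply: contra x2O.
  by rewrite -!fconnect_orbit in x1O *; apply: connect_trans.
have disO z : z \in orbit s x1 -> z \in orbit s x2 -> False.
  rewrite -!fconnect_orbit in x2O1 * => c1 c2; case/negP: x2O1.
  by rewrite (connect_trans c1) // fconnect_sym.
have [o1D cyc1] := orbit_edge_cycle sD x1D.
have [o2D cyc2] := orbit_edge_cycle sD x2D.
have disr z : z \in r -> (z \in orbit s x1) = false /\ (z \in orbit s x2) = false.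
  move=> /rP[zD _]; split; apply/negbTE; apply: contra zD => zO.
    exact: o1D.
  exact: o2D.
move: (orbit_uniq s x1) (orbit_uniq s x2) (size_orbit s x1) (size_orbit s x2).
have [_ _ od1] := sD _ x1D; have [_ _ od2] := sD _ x2D.
set c1 := orbit s x1 in disO cyc1 o1D disr x2O1 *.
set c2 := orbit s x2 in disO cyc2 o2D disr *.
have E1 : c1 = x1 :: behead c1 by apply: orbit_cons.
have E2 : c2 = x2 :: behead c2 by apply: orbit_cons.
move: (behead c1) (behead c2) E1 E2 => p1 p2 E1 E2 uc1 uc2 sz1 sz2.
have ep1 : ~~ odd (size p1) by move: od1; rewrite -sz1 E1.
have ep2 : ~~ odd (size p2) by move: od2; rewrite -sz2 E2.
have ur' : uniq r by move: ur; rewrite /= rcons_uniq => /and3P[].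
have db : dumbbell x1 p1 x2 p2 r.
  split; rewrite -?E1 -?E2 //.
  rewrite !cat_uniq uc1 uc2 ur' /= andbT has_cat negb_or -andbA.
  apply/and3P; split; apply/hasPn=> z zr; apply/negP=> zc.
  - exact: disO zc zr.
  - by have [] := disr _ zr; rewrite zc.
  - by have [_] := disr _ zr; rewrite zc.
pose B := [set z in c1 ++ c2 ++ r].
have BE : dumbbell_set x1 p1 x2 p2 r = B by rewrite /dumbbell_set -E1 -E2.
have Bin z : (z \in B) = [|| z \in c1, z \in c2 | z \in r].
  by rewrite inE !mem_cat.
have [D'0|D'0] := eqVneq (D :\: B) set0.
  exists x1, p1, x2, p2, r; split=> //.
  exists t => z; rewrite BE inE => zB.
  have zD : z \in ~: D.
    by rewrite inE; apply: contraFN (in_set0 z) => zD; rewrite -D'0 inE zB.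
  have [tzD tK te] := tP z zD; split=> //.
  move: zB tzD; rewrite !inE !mem_cat !negb_or => /and3P[_ _ zr] tzD.
  rewrite (contra (@o1D _)) // (contra (@o2D _)) //=.
  by apply: contra zr => /rP[_]; rewrite tK.
have [|||y1 [q1 [y2 [q2 [r' Hr']]]]] := IHn (D :\: B) _ D'0.
- rewrite ltnS in szD; apply: leq_trans szD; apply: proper_card.
  rewrite properEneq subsetDl andbT; apply/eqP=> /setP/(_ x1).
  by rewrite !inE E1 mem_head x1D.
- move=> z; rewrite !inE !mem_cat !negb_or -!andbA => /and4P[zc1 zc2 zr zD].
  have [sz' ze od] := sD z zD; split=> //; rewrite sz' andbT.
  apply/and3P; split.
  + by rewrite -fconnect_orbit -(same_fconnect1_r s_inj) fconnect_orbit.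
  + by rewrite -fconnect_orbit -(same_fconnect1_r s_inj) fconnect_orbit.
  + by apply/negP=> /rP[]; rewrite sz'.
(* The complement of [D :\: B] is matched by the given matching outside [B]
   and by matchings of three even paths inside [B]: the joining path with both
   ends, and what remains of each cycle. *)
- have sP x p : cycle (@sedge G) (x :: p) -> sorted (@sedge G) p.
    by rewrite /= rcons_path => /andP[/path_sorted].
  have M1 : matchable [set z in p1].
    apply: matchable_sorted => //; last by apply: (sP x1); rewrite -E1; apply: cyc1.
    by move: uc1; rewrite E1 => /andP[].
  have M2 : matchable [set z in p2].
    apply: matchable_sorted => //; last by apply: (sP x2); rewrite -E2; apply: cyc2.
    by move: uc2; rewrite E2 => /andP[].
  have MP : matchable [set z in x1 :: rcons r x2].
    by apply: matchable_sorted => //=; rewrite size_rcons /= negbK.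
  have MR : @matchable G (~: D :\: [set z in r]).
    exists t => z; rewrite !inE => /andP[zr zD].
    have [|] := tP z _; first by rewrite inE.
    rewrite inE => tzD tK te; split=> //; rewrite tzD andbT.
    by apply: contra zr => /rP[_]; rewrite tK.
  have -> : ~: (D :\: B) = (~: D :\: [set z in r]) :|:
      ([set z in x1 :: rcons r x2] :|: ([set z in p1] :|: [set z in p2])).
    apply/setP=> z; rewrite in_setC in_setD Bin E1 E2.
    rewrite !inE mem_rcons inE negb_and negbK.
    case: (z \in D); case: (z \in r); case: (z \in p1); case: (z \in p2);
      case: (z == x1); case: (z == x2) => //=.
  have notin_c z : z \notin D -> (z \notin c1) && (z \notin c2).
    by move=> zD; rewrite (contra (@o1D z) zD) (contra (@o2D z) zD).
  apply: matchableU MR (matchableU _ MP (matchableU _ M1 M2)).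
  + rewrite disjoint_subset; apply/subsetP=> z; rewrite !inE => /andP[zr zD].
    have := notin_c z zD; rewrite E1 E2 !inE mem_rcons inE (negbTE zr) orbF.
    by rewrite !negb_or => /andP[/andP[-> ->] /andP[-> ->]].
  + rewrite disjoint_subset; apply/subsetP=> z; rewrite !inE mem_rcons inE.
    have := uc1; have := uc2; rewrite E1 E2 /= => /andP[x2p _] /andP[x1p _].
    have x1p2 : x1 \notin p2.
      by apply/negP => H; apply: (disO x1); rewrite ?E1 ?E2 inE ?eqxx ?H ?orbT.
    move: x2O1; rewrite E1 inE negb_or => /andP[_ x2p1].
    case/or3P=> [/eqP->|/eqP->|zr]; rewrite negb_or; apply/andP; split=> //.
      by have [+ _] := disr z zr; rewrite E1 inE => /negbT/norP[].
    by have [_] := disr z zr; rewrite E2 inE => /negbT/norP[].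
  + rewrite disjoint_subset; apply/subsetP=> z; rewrite !inE => z1.
    by apply/negP=> z2; apply: (disO z); rewrite ?E1 ?E2 inE ?z1 ?z2 orbT.
- by exists y1, q1, y2, q2, r'.
Qed.

End Reduction.

(** * The subgraph carrying a subdivision *)

Lemma path_infix2P (T : eqType) (e : rel T) (a : T) (p : seq T) :
  path e a p <-> (forall x y, infix [:: x; y] (a :: p) -> e x y).
Proof.
elim: p a => [|b p IHp] a; first by split=> // _ x y /size_infix.
split=> [/andP[ab bp] x y|H].
  rewrite infix_consl /= => /orP[|]; last exact: (IHp b).1.
  by case/andP=> /eqP-> /andP[/eqP-> _].
apply/andP; split; first by apply: H; rewrite infix_consl /= !eqxx prefix0s.
by apply/IHp=> x y xy; apply: H; rewrite infix_consl xy orbT.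
Qed.

(** A subdivision given by vertices and paths of an ambient graph [G] yields a
subgraph of [G] that is one in the abstract sense. The hypotheses are the
conditions of [is_even_subdivision], with the paths taken in [G]. *)
Section SubdivisionSubgraph.
Variables (J G : sgraph) (f : J -> G) (P : J -> J -> seq G).
Hypothesis f_inj : injective f.
Hypothesis P_rev : forall u v, u -- v -> P v u = rev (P u v).
Hypothesis P_uniq : forall u v, u -- v -> uniq (P u v).
Hypothesis P_even : forall u v, u -- v -> ~~ odd (size (P u v)).
Hypothesis P_internal : forall u v w, u -- v -> f w \notin P u v.
Hypothesis P_disjoint : forall u v u' v' x, u -- v -> u' -- v' ->
  x \in P u v -> x \in P u' v' -> [set u; v] = [set u'; v'].
Hypothesis P_path :
  forall u v, u -- v -> path (@sedge G) (f u) (rcons (P u v) (f v)).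

Definition subdiv_vset : {set G} :=
  [set x | [exists u, x == f u] ||
    [exists u : J, [exists v : J, (u -- v) && (x \in P u v)]]].

Definition subdiv_rel : rel G := fun x y => [exists u : J, [exists v : J,
  (u -- v) && infix [:: x; y] (f u :: rcons (P u v) (f v))]].

Lemma subdiv_relP x y : reflect
  (exists u v, u -- v /\ infix [:: x; y] (f u :: rcons (P u v) (f v)))
  (subdiv_rel x y).
Proof.
apply: (iffP existsP) => [[u /existsP[v /andP[uv i]]]|[u [v [uv i]]]].
  by exists u, v.
by exists u; apply/existsP; exists v; rewrite uv.
Qed.

Lemma subdiv_vsetP x : reflect
  ((exists u, x = f u) \/ (exists u v, u -- v /\ x \in P u v))
  (x \in subdiv_vset).
Proof.
rewrite inE; apply: (iffP orP) => -[H|H].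
- by left; case/existsP: H => u /eqP ->; exists u.
- by right; case/existsP: H => u /existsP[v /andP[]]; exists u, v.
- by left; apply/existsP; case: H => u ->; exists u.
- right; case: H => u [v [uv xP]]; apply/existsP; exists u.
  by apply/existsP; exists v; rewrite uv.
Qed.

Lemma subdiv_rel_sym : symmetric subdiv_rel.
Proof.
have H x y : subdiv_rel x y -> subdiv_rel y x.
  case/subdiv_relP=> u [v [uv i]]; apply/subdiv_relP; exists v, u.
  rewrite sedge_sym uv (P_rev uv); split=> //.
  have := infix_rev [:: x; y] (f u :: rcons (P u v) (f v)).
  by rewrite i [rev (f u :: _)]rev_cons rev_rcons rcons_cons.
by move=> x y; apply/idP/idP; apply: H.
Qed.

Lemma subdiv_relW x y : subdiv_rel x y ->
  [/\ x \in subdiv_vset, y \in subdiv_vset & x -- y].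
Proof.
case/subdiv_relP=> u [v [uv i]]; rewrite ((path_infix2P _ _ _).1 (P_path uv)) //.
have sV z : z \in [:: x; y] -> z \in subdiv_vset.
  move=> /(mem_infix i); rewrite inE mem_rcons inE => zP; apply/subdiv_vsetP.
  by case/or3P: zP => [/eqP->|/eqP->|zP]; [left; exists u|left; exists v|
    right; exists u, v].
by split=> //; apply: sV; rewrite !inE eqxx ?orbT.
Qed.

Definition subdiv_subgraph : subgraph G := Subgraph subdiv_rel_sym subdiv_relW.

Lemma even_subdivision_subdiv : even_subdivision J subdiv_subgraph.
Proof.
have fV u : f u \in subdiv_vset by apply/subdiv_vsetP; left; exists u.
pose g u : subdiv_subgraph := Sub (f u) (fV u).
pose Q u v : seq subdiv_subgraph := pmap insub (P u v).
have QE u v : u -- v -> map val (Q u v) = P u v.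
  move=> uv; rewrite (pmap_filter (@insubK _ _ _)).
  apply/all_filterP/allP=> x xP; rewrite isSome_insub.
  by apply/subdiv_vsetP; right; exists u, v.
have QP u v (x : subdiv_subgraph) : u -- v -> (x \in Q u v) = (val x \in P u v).
  by move=> uv; rewrite -QE // mem_map //; apply: val_inj.
have Qinf u v (x y : subdiv_subgraph) : u -- v ->
    infix [:: x; y] (g u :: rcons (Q u v) (g v)) =
    infix [:: val x; val y] (f u :: rcons (P u v) (f v)).
  move=> uv; rewrite -QE // -[f u]/(val (g u)) -[f v]/(val (g v)).
  rewrite -map_rcons -!map_cons; apply/infixP/infixP.
    by case=> s [s' E]; exists (map val s), (map val s'); rewrite E !map_cat.
  case=> s [s' E].
  have {}E : map val (g u :: rcons (Q u v) (g v)) =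
    s ++ [:: val x, val y & s'] by exact: E.
  move: (g u :: _) E => L E.
  exists (take (size s) L), (drop (size s).+2 L).
  apply: (inj_map val_inj); rewrite E !map_cat /= map_take map_drop E.
  by rewrite take_size_cat // drop_cat ltnNge leqW ?leqnSn //=
    subSn ?leqnSn // subSnn /= drop0.
exists g, Q; split.
- by move=> u v [/f_inj].
- move=> u v uv; apply: (inj_map val_inj).
  have vu : v -- u by rewrite sedge_sym.
  by rewrite map_rev (QE _ _ uv) (QE _ _ vu) (P_rev uv).
- by move=> u v uv; rewrite -(map_inj_uniq val_inj) QE ?P_uniq.
- by move=> u v uv; rewrite -(size_map val) QE ?P_even.
- by move=> u v w uv; rewrite QP ?P_internal.
- by move=> u v u' v' x uv uv'; rewrite !QP //; apply: P_disjoint.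
- move=> x; have /subdiv_vsetP := valP x.
  case=> [[u E]|[u [v [uv xP]]]]; [left; exists u|right; exists u, v].
    exact: val_inj.
  by rewrite QP.
- move=> x y; split=> [/subdiv_relP[u [v [uv i]]]|[u [v [uv i]]]].
    by exists u, v; rewrite Qinf.
  by apply/subdiv_relP; exists u, v; rewrite -Qinf.
Qed.

End SubdivisionSubgraph.

(** * Dumbbells are even subdivisions of T *)

Lemma path_rev_sym (T : eqType) (e : rel T) (x y : T) (p : seq T) :
  symmetric e -> path e x (rcons p y) -> path e y (rcons (rev p) x).
Proof.
move=> e_sym xpy; have := rev_path e x (rcons p y).
rewrite last_rcons belast_rcons rev_cons => ->.
by rewrite (eq_path (e' := e)) // => u v; rewrite e_sym.
Qed.

Lemma T_edgeE (u v : T_graph) : u -- v = T_rel u v.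
Proof. by []. Qed.

Section DumbbellSubdivision.
Variables (G : sgraph) (x1 : G) (p1 : seq G) (x2 : G) (p2 r : seq G).
Hypothesis db : dumbbell x1 p1 x2 p2 r.

Let c (b : bool) : seq G := if b then x2 :: p2 else x1 :: p1.
Let q b := drop 3 (c b).
Let f (u : T_graph) : G := nth x1 (c u.1) u.2.
(** Each triangle keeps its first three vertices as branch vertices, so the
only subdivided edge of triangle [b] is the one closing the cycle. *)
Let P (u v : T_graph) : seq G :=
  if u.1 == v.1 then
    if (u.2 == 2 :> nat) && (v.2 == 0 :> nat) then q u.1
    else if (u.2 == 0 :> nat) && (v.2 == 2 :> nat) then rev (q u.1) else [::]
  else if u.1 then rev r else r.

Let uniq_all : [/\ forall b, uniq (c b), uniq r,
  forall b x, x \in c b -> x \notin r &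
  forall b b' x, x \in c b -> x \in c b' -> b = b'].
Proof.
have := dumbbell_uniq db; rewrite !cat_uniq has_cat negb_or -andbA.
case/and5P=> u1 /hasPn d12 /hasPn d1r u2 /andP[/hasPn d2r ur].
split=> // [[] //|[] x xc|[] [] x xc xc' //].
- by apply/negP=> /d2r; rewrite xc.
- by apply/negP=> /d1r; rewrite xc.
- by have := d12 _ xc; rewrite xc'.
- by have := d12 _ xc'; rewrite xc.
Qed.

Let cE b : c b = [:: f (b, inord 0), f (b, inord 1), f (b, inord 2) & q b].
Proof.
rewrite /q /f /= !inordK //.
have : cycle (@sedge G) (c b) /\ odd (size (c b)).
  by case: db; case: b.
case: (c b) => [|x [|y [|z s]]] [//] /=; rewrite ?sedge_irrefl //.
by rewrite drop0.
Qed.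

Let T_ord (i : 'I_3) : [\/ i = inord 0, i = inord 1 | i = inord 2].
Proof.
by case: i => [[|[|[|//]]] ?]; [constructor 1|constructor 2|constructor 3];
  apply: val_inj; rewrite /= inordK.
Qed.

Let q_even b : ~~ odd (size (q b)).
Proof.
have : odd (size (c b)) by case: db; case: b.
by rewrite cE /= !negbK.
Qed.

Let qc b x : x \in q b -> x \in c b.
Proof. exact: mem_drop. Qed.

Let fc u : f u \in c u.1.
Proof.
case: u => b i; rewrite cE.
by case: (T_ord i) => ->; rewrite !inE eqxx ?orbT.
Qed.

Let f_inj : injective f.
Proof.
have [uc _ _ d] := uniq_all.
move=> [b i] [b' j] E; have Eb := d _ _ _ (fc (b, i)); rewrite E in Eb.
have {}Eb := Eb _ (fc (b', j)); rewrite /= in Eb; subst b'; congr (_, _).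
have sz : 3 <= size (c b) by rewrite cE.
apply/val_inj/eqP; rewrite -(nth_uniq x1 _ _ (uc b)); first exact/eqP.
  exact: leq_trans (ltn_ord i) sz.
exact: leq_trans (ltn_ord j) sz.
Qed.

Let P_mem u v x : u -- v -> x \in P u v ->
  (exists2 b, x \in q b & [set u; v] = [set (b, inord 0); (b, inord 2)]) \/
  (x \in r /\ [set u; v] = [set (false, inord 0); (true, inord 0)]).
Proof.
case: u v => [b i] [b' j]; rewrite T_edgeE /T_rel /P /=.
case: eqP => [<-{b'} _|/eqP nb].
  case: (T_ord i) (T_ord j) => -> [] ->; rewrite !inordK //= ?mem_rev => xq.
    by left; exists b.
  by left; exists b => //; rewrite setUC.
have -> : ord0 = inord 0 :> 'I_3 by apply: val_inj; rewrite /= inordK.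
case/andP=> /eqP -> /eqP ->; right.
by case: b b' nb H => [] []; rewrite ?mem_rev //; rewrite setUC.
Qed.

Let P_path u v : u -- v -> path (@sedge G) (f u) (rcons (P u v) (f v)).
Proof.
have cyc b : cycle (@sedge G) (c b) by case: db; case: b.
have P20 b : path (@sedge G) (f (b, inord 2)) (rcons (q b) (f (b, inord 0))).
  by have := cyc b; rewrite cE /= => /and3P[].
have e01 b : f (b, inord 0) -- f (b, inord 1).
  by have := cyc b; rewrite cE /= => /and3P[].
have e12 b : f (b, inord 1) -- f (b, inord 2).
  by have := cyc b; rewrite cE /= => /and3P[].
have Pr : path (@sedge G) (f (false, inord 0)) (rcons r (f (true, inord 0))).
  by rewrite /f /= inordK //; case: db.
case: u v => [b i] [b' j]; rewrite T_edgeE /T_rel /P /=.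
case: eqP => [<-{b'}|/eqP nb].
  case: (T_ord i) (T_ord j) => -> [] ->; rewrite ?eqxx !inordK //= => _;
    rewrite ?andbT //; try by rewrite sedge_sym.
  exact: path_rev_sym (@sedge_sym G) _.
have -> : ord0 = inord 0 :> 'I_3 by apply: val_inj; rewrite /= inordK.
case/andP=> /eqP -> /eqP ->.
case: b b' nb => [] [] // _.
exact: path_rev_sym (@sedge_sym G) _.
Qed.

Lemma dumbbell_subdivision :
  exists2 H : subgraph G, sub_vset H = dumbbell_set x1 p1 x2 p2 r &
    even_subdivision T_graph H.
Proof.
have [uc ur dr d] := uniq_all.
have P_rev u v : u -- v -> P v u = rev (P u v).
  case: u v => [b i] [b' j]; rewrite T_edgeE /T_rel /P /= [b' == b]eq_sym.
  case: eqP => [<-{b'} _|/eqP nb _].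
    by case: (T_ord i) (T_ord j) => -> [] ->; rewrite !inordK //= revK.
  by case: b b' nb => [] []; rewrite ?revK.
have P_uniq u v : u -- v -> uniq (P u v).
  move=> _; rewrite /P; do !case: ifP => _ //; rewrite ?rev_uniq //.
    exact: drop_uniq.
  exact: drop_uniq.
have P_even u v : u -- v -> ~~ odd (size (P u v)).
  by move=> _; rewrite /P; do !case: ifP => _ //; rewrite ?size_rev //; case: db.
have q_notin b w : f w \notin q b.
  apply/negP; case: w => b' i fq.
  have /= E := d _ _ _ (qc fq) (fc (b', i)); subst b'.
  have := uc b; rewrite cE /= !inE !negb_or -!andbA => /and5P[_ _ n0 _ /andP[n1 /andP[n2 _]]].
  by case: (T_ord i) fq => ->; apply/negP.
have P_internal u v w : u -- v -> f w \notin P u v.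
  move=> uv; apply/negP => /(P_mem uv)[[b fq _]|[fr _]].
    by case/negP: (q_notin b w).
  by case/negP: (dr _ _ (fc w)).
have P_disjoint u v u' v' x : u -- v -> u' -- v' ->
    x \in P u v -> x \in P u' v' -> [set u; v] = [set u'; v'].
  move=> uv uv' /(P_mem uv)[[b xb ->]|[xr ->]] /(P_mem uv')[[b' xb' ->]|[xr' ->]] //.
  - by rewrite (d _ _ _ (qc xb) (qc xb')).
  - by case/negP: (dr _ _ (qc xb)).
  - by case/negP: (dr _ _ (qc xb')).
exists (subdiv_subgraph P_rev P_path); last exact: even_subdivision_subdiv.
apply/setP=> x; rewrite /dumbbell_set [RHS]inE.
rewrite -[_ ++ _ ++ r]/(c false ++ c true ++ r) !mem_cat.
apply/subdiv_vsetP/or3P => [[[u ->]|[u [v [uv /(P_mem uv)]]]]|].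
- have := fc u; case: (u.1) => fu; [exact: Or32|exact: Or31].
- by case=> [[[] /qc xc _]|[xr _]]; [exact: Or32|exact: Or31|exact: Or33].
- have cP b : x \in c b -> (exists u, x = f u) \/
      (exists u v, u -- v /\ x \in P u v).
    rewrite cE !inE => /or4P[/eqP->|/eqP->|/eqP->|xq].
    + by left; eexists.
    + by left; eexists.
    + by left; eexists.
    + right; exists (b, inord 2), (b, inord 0).
      by rewrite T_edgeE /T_rel /P /= eqxx -val_eqE /= !inordK.
  case=> [/cP //|/cP //|xr]; right; exists (false, ord0), (true, ord0).
  by rewrite T_edgeE /T_rel /P /= eqxx.
Qed.

End DumbbellSubdivision.

(** * Even subdivisions of T are dumbbells *)

Lemma set2_inj (T : finType) (a b c d : T) :
  [set a; b] = [set c; d] -> (a, b) = (c, d) \/ (a, b) = (d, c).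
Proof.
move=> E; have := set21 a b; rewrite E !inE => /orP[]/eqP Ea; rewrite {}Ea in E *.
  have := set22 c b; rewrite E !inE => /orP[]/eqP Eb; last by left; rewrite Eb.
  by have := set22 c d; rewrite -E Eb !inE orbb => /eqP->; left.
have := set22 d b; rewrite E !inE => /orP[]/eqP Eb; first by right; rewrite Eb.
by have := set21 c d; rewrite -E Eb !inE orbb => /eqP->; right.
Qed.

Lemma uniq_flatten_map (S T : eqType) (F : S -> seq T) (es : seq S) :
  uniq es -> {in es, forall e, uniq (F e)} ->
  {in es &, forall e e' x, x \in F e -> x \in F e' -> e = e'} ->
  uniq (flatten (map F es)).
Proof.
elim: es => //= e es IHes /andP[ees ues] uF dF.
rewrite cat_uniq uF ?mem_head //= IHes //; last first.
- by move=> e1 e2 h1 h2; apply: dF; rewrite inE ?h1 ?h2 orbT.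
- by move=> e1 h1; apply: uF; rewrite inE h1 orbT.
rewrite andbT; apply/hasPn=> x /flattenP[s /mapP[e' e'es ->] xe'].
apply/negP=> xe; case/negP: ees.
by rewrite (dF e e' _ _ x xe xe') // inE ?eqxx ?e'es ?orbT.
Qed.

Section SubdivisionDumbbell.
Variables (K : sgraph) (f : T_graph -> K) (P : T_graph -> T_graph -> seq K).
Hypothesis subP : is_even_subdivision f P.

Let v (b : bool) (i : 'I_3) : T_graph := (b, i).
Let i0 : 'I_3 := @Ordinal 3 0 isT.
Let i1 : 'I_3 := @Ordinal 3 1 isT.
Let i2 : 'I_3 := @Ordinal 3 2 isT.
Let p (b : bool) : seq K :=
  P (v b i0) (v b i1) ++ f (v b i1) ::
  P (v b i1) (v b i2) ++ f (v b i2) :: P (v b i2) (v b i0).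
Let r := P (v false i0) (v true i0).

Let sub_path u w : u -- w -> path (@sedge K) (f u) (rcons (P u w) (f w)).
Proof.
by move=> uw; apply/path_infix2P => x y i; apply/(esub_edge subP); exists u, w.
Qed.

Let vs : seq T_graph := [seq (b, i) | b <- [:: false; true], i <- [:: i0; i1; i2]].
(** Each edge of T in one orientation only: the two orientations of an edge
give the same interior vertices. *)
Let es : seq (T_graph * T_graph) := (v false i0, v true i0) ::
  [seq (v b e.1, v b e.2) | b <- [:: false; true],
    e <- [:: (i0, i1); (i1, i2); (i2, i0)]].

Let es_edge : {in es, forall e, e.1 -- e.2}.
Proof. by apply/allP. Qed.

Let I3P (i : 'I_3) : [\/ i = i0, i = i1 | i = i2].
Proof.
by case: i => [[|[|[|//]]] ?]; [constructor 1|constructor 2|constructor 3];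
  apply: val_inj.
Qed.

Let es_all (u w : T_graph) : u -- w -> ((u, w) \in es) || ((w, u) \in es).
Proof.
case: u w => [b i] [b' j].
by case: (I3P i) (I3P j) b b' => -> [] -> [] [].
Qed.

(** Branch vertices and path interiors are pairwise disjoint; the two cycles
and the joining path are then obtained by rearranging this list. *)
Let pieces_uniq : uniq (map f vs ++ flatten [seq P e.1 e.2 | e <- es]).
Proof.
rewrite cat_uniq (map_inj_uniq (esub_inj subP)) andTb.
apply/andP; split.
  apply/hasPn=> x /flattenP[s /mapP[e /es_edge ee ->] xe].
  apply/negP=> /mapP[w _ E].
  by have := esub_internal subP w ee; rewrite -E xe.
apply: uniq_flatten_map => // [e /es_edge/(esub_uniq subP) //|e e' ees e'es x xe xe'].
have := esub_disjoint subP (es_edge ees) (es_edge e'es) xe xe'.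
case/set2_inj; rewrite -!surjective_pairing // => E.
have /allP/(_ _ e'es) : all (fun e => (e.2, e.1) \notin es) es by [].
by rewrite -E ees.
Qed.

Lemma subdivision_dumbbell :
  exists (x1 : K) p1 x2 p2 s, dumbbell x1 p1 x2 p2 s /\
    forall x, x \in (x1 :: p1) ++ (x2 :: p2) ++ s.
Proof.
exists (f (v false i0)), (p false), (f (v true i0)), (p true), r.
have E : perm_eq (map f vs ++ flatten [seq P e.1 e.2 | e <- es])
  ((f (v false i0) :: p false) ++ (f (v true i0) :: p true) ++ r).
  apply/permP=> a; do 4!rewrite /= ?count_cat; rewrite /p /r /v; do 4!rewrite /= ?count_cat; lia.
have cyc b : cycle (@sedge K) (f (v b i0) :: p b).
  rewrite /= rcons_cat cat_path /= rcons_cat cat_path /=.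
  have P01 : v b i0 -- v b i1 by rewrite T_edgeE /T_rel eqxx.
  have P12 : v b i1 -- v b i2 by rewrite T_edgeE /T_rel eqxx.
  have P20 : v b i2 -- v b i0 by rewrite T_edgeE /T_rel eqxx.
  have := sub_path P01; rewrite rcons_path => /andP[-> ->].
  have := sub_path P12; rewrite rcons_path => /andP[-> ->].
  by rewrite (sub_path P20).
have ev b : ~~ odd (size (p b)).
  rewrite /p !(size_cat, oddD) /= !(size_cat, oddD) /=.
  by rewrite !(negbTE (esub_even subP _)) // T_edgeE /T_rel eqxx.
split.
  split=> //; first by rewrite -(perm_uniq E) pieces_uniq.
    by apply: (esub_even subP).
  by apply: sub_path.
move=> x; rewrite -(perm_mem E) mem_cat; apply/orP.
have [[u ->]|[u [w [uw xP]]]] := esub_vertex subP x.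
  left; apply: map_f; case: u => b i.
  by case: (I3P i) b => -> [].
right; apply/flattenP; case/orP: (es_all uw) => e_in.
  by exists (P u w) => //; apply: (map_f (fun e => P e.1 e.2) e_in).
exists (P w u); first by apply: (map_f (fun e => P e.1 e.2) e_in).
by rewrite (esub_rev subP uw) mem_rev.
Qed.

End SubdivisionDumbbell.

(** * Spanning subgraphs of edges and odd cycles as permutations *)

(** Orbits are described through iterates rather than through [order],
because equations between iterates are easily carried from a subgraph to the
ambient graph and back. *)
Definition odd_cover (G : sgraph) : Prop :=
  exists s : G -> G,
    [/\ injective s, forall x, x -- s x,
        forall x, iter 2 s x = x \/ exists2 n, odd n & iter n s x = x
      & exists x n, odd n /\ iter n s x = x].

Lemma iter_mul_fixed (T : Type) (s : T -> T) (x : T) (k n : nat) :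
  iter n s x = x -> iter (k * n) s x = x.
Proof. by move=> E; elim: k => // k IHk; rewrite mulSn iterD IHk. Qed.

Lemma order_dvdn (T : finType) (s : T -> T) (x : T) (n : nat) :
  injective s -> iter n s x = x -> order s x %| n.
Proof.
move=> s_inj E; have o0 := order_gt0 s x.
have itM q : iter (q * order s x) s x = x by apply/iter_mul_fixed/iter_order.
rewrite /dvdn -[X in X == 0](findex_iter (ltn_pmod n o0)).
rewrite -[X in iter _ s X](itM (n %/ order s x)) -iterD addnC -divn_eq E.
by rewrite findex0.
Qed.

Lemma connect_equivalence (K : sgraph) :
  {in [set: K] & &, equivalence_rel (connect (@sedge K))}.
Proof.
move=> x y z _ _ _; split=> [|xy]; first exact: connect0.
exact: (same_connect (sym_connect_sym (@sedge_sym K)) xy).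
Qed.

Lemma components_partition (K : sgraph) : partition (components K) [set: K].
Proof. exact: equivalence_partitionP (@connect_equivalence K). Qed.

(** A permutation of a model graph that moves along edges is transported to a
component isomorphic to the model; the models are [K_2] and the odd cycles,
rotated by [ordS]. *)
Lemma rotation_of_iso (K J : sgraph) (C : {set K}) (h : J -> J) (n : nat) :
    isomorphic (induced C) J -> (forall j, j -- h j) ->
    (forall j, iter n h j = j) ->
  exists g : K -> K, {in C, forall x, [/\ g x \in C, x -- g x & iter n g x = x]}.
Proof.
case=> f [[f' fK f'K] fe] he hn.
pose g x := if insub x is Some u then val (f' (h (f u))) else x.
have gE (u : induced C) : g (val u) = val (f' (h (f u))) by rewrite /g valK.
exists g => x xC; rewrite -[x]/(val (Sub x xC : induced C)).
move: (Sub x xC : induced C) => u; split.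
- by rewrite gE; apply: valP.
- by rewrite gE -[_ -- _]/(u -- f' (h (f u))) -fe f'K.
have -> : iter n g (val u) = val (f' (iter n h (f u))).
  by elim: n {hn} => [|n IHn]; rewrite /= ?fK // IHn gE f'K.
by rewrite hn fK.
Qed.

Lemma iter_ordS n (i : 'I_n) : iter n (@ordS n) i = i.
Proof.
have E k : iter k (@ordS n) i = (i + k) %% n :> nat.
  elim: k => [|k IHk]; first by rewrite addn0 modn_small.
  by rewrite iterS /= IHk -[(_ %% n).+1]addn1 modnDml addn1 addnS.
by apply: val_inj; rewrite /= E modnDr modn_small.
Qed.

Lemma ordS_neq n (i : 'I_n) : 1 < n -> i != ordS i.
Proof.
move=> n1; apply/eqP=> /(congr1 val) /= E; have := ltn_ord i.
rewrite leq_eqVlt => /orP[/eqP iE|lt]; last by rewrite modn_small // in E; lia.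
by rewrite -[X in _ %% X]iE modnn in E; lia.
Qed.

Lemma isomorphic_card (G H : sgraph) : isomorphic G H -> #|G| = #|H|.
Proof. by case=> f [f_bij _]; apply: bij_eq_card f_bij. Qed.

(** The second clause excludes the exponent 2 on odd cycles, which matters to
find an odd orbit in the end; it holds because [K_2] has an even number of
vertices. *)
Lemma component_rotation (K : sgraph) (C : {set K}) :
    isomorphic (induced C) (complete_graph 2) \/ is_odd_cycle (induced C) ->
  exists (g : K -> K) n, [/\ n = 2 \/ odd n, is_odd_cycle (induced C) -> odd n &
    {in C, forall x, [/\ g x \in C, x -- g x & iter n g x = x]}].
Proof.
case=> [iso|[n [n3 odd_n iso]]].
  have [|g Hg] := @rotation_of_iso _ (complete_graph 2) C (@ordS 2) 2 iso _ (@iter_ordS 2).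
    by move=> j; apply: ordS_neq.
  exists g, 2; split=> //; first by left.
  case=> n [_ odd_n iso']; move: odd_n.
  by rewrite -[n]card_ord -(isomorphic_card iso') (isomorphic_card iso) card_ord.
have [|g Hg] := @rotation_of_iso _ (cycle_graph n) C (@ordS n) n iso _ (@iter_ordS n).
  by move=> j; rewrite /sedge /= /cycle_rel eqxx ordS_neq // ltnW.
by exists g, n; split=> //; right.
Qed.

(** Each component is permuted by its own rotation. Injectivity holds because
the rotation preserves the component and some positive power of it is the
identity there. *)
Lemma odd_cover_of_components (K : sgraph) :
  edges_and_odd_cycles K -> odd_cover K.
Proof.
case=> comp [C0 C0comp C0odd]; have parK := components_partition K.
have tri := partition_trivIset parK.
pose ok (C : {set K}) (gn : (K -> K) * nat) := C \in components K ->
  [/\ gn.2 = 2 \/ odd gn.2, is_odd_cycle (induced C) -> odd gn.2 &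
    {in C, forall x, [/\ gn.1 x \in C, x -- gn.1 x & iter gn.2 gn.1 x = x]}].
have ex C : exists gn, ok C gn.
  have [Cc|nC] := boolP (C \in components K); last first.
    by exists (id, 0) => Cc; rewrite Cc in nC.
  by have [g [n Hgn]] := component_rotation (comp C Cc); exists (g, n).
have [gn Hgn] := fin_all_exists ex; pose blk := pblock (components K).
have blkP x : blk x \in components K /\ x \in blk x.
  have xc : x \in cover (components K) by rewrite (cover_partition parK).
  by split; [apply: pblock_mem | rewrite mem_pblock].
pose s x := (gn (blk x)).1 x.
have blkE C x : C \in components K -> x \in C -> blk x = C.
  exact: def_pblock.
have sblk x : blk (s x) = blk x.
  have [b1 b2] := blkP x; apply: (blkE _ _ b1).
  by have [_ _ /(_ _ b2)[]] := Hgn _ b1.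
have iters n x : iter n s x = iter n (gn (blk x)).1 x /\ blk (iter n s x) = blk x.
  elim: n => //= n [IH1 IH2]; rewrite sblk IH2; split=> //.
  by rewrite -IH1 /s IH2.
have iterK x : iter (gn (blk x)).2 s x = x.
  have [b1 b2] := blkP x; rewrite (iters _ x).1.
  by have [_ _ /(_ _ b2)[]] := Hgn _ b1.
exists s; split.
- move=> x y E; have Eb : blk x = blk y by rewrite -(sblk x) E sblk.
  have := iterK y; have := iterK x; rewrite Eb.
  have [+ _ _] := Hgn _ (blkP y).1; case: (gn _).2 => [[]//|n _].
  by rewrite !iterSr E => -> .
- move=> x; have [b1 b2] := blkP x.
  by have [_ _ /(_ _ b2)[]] := Hgn _ b1.
- move=> x; have [+ _ _] := Hgn _ (blkP x).1.
  by case=> E; [left|right]; rewrite -?E ?iterK //; exists (gn (blk x)).2.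
have /set0Pn[x xC] : C0 != set0 by apply: (partition_neq0 parK).
exists x, (gn (blk x)).2; split; last exact: iterK.
have [_ + _] := Hgn _ C0comp; rewrite (blkE C0) //; exact.
Qed.

Lemma odd_cover_of_spanning (G : sgraph) (H : subgraph G) :
  spanning H -> edges_and_odd_cycles H -> odd_cover G.
Proof.
move=> spH /odd_cover_of_components[s [s_inj s_edge s_iter [x0 [n0 [odd0 E0]]]]].
have inH x : x \in sub_vset H by rewrite spH inE.
pose in_H x : H := Sub x (inH x).
have valH (u : H) : in_H (val u) = u by apply: val_inj.
pose t x := val (s (in_H x)).
have titer n (u : H) : iter n t (val u) = val (iter n s u).
  by elim: n => //= n ->; rewrite /t valH.
exists t; split.
- by move=> x y /val_inj/s_inj/(congr1 val).
- by move=> x; have /sub_edgeP[] := s_edge (in_H x).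
- move=> x; rewrite -[x]/(val (in_H x)).
  case: (s_iter (in_H x)) => [E|[n odd_n E]]; [left|right].
    by rewrite titer E.
  by exists n => //; rewrite titer E.
- by exists (val x0), n0; rewrite titer E0.
Qed.

(** A graph whose edges are the pairs [x], [s x] for a permutation [s]: its
components are the orbits of [s], and each is a cycle, numbered along the
iterates of [s] (for an orbit of size 2, a single edge). *)
Section OrbitCycle.
Variables (K : sgraph) (s : K -> K).
Hypothesis s_inj : injective s.
Hypothesis sE : forall x y : K, x -- y = (y == s x) || (x == s y).

Lemma connect_orbit x y : connect (@sedge K) x y = fconnect s x y.
Proof.
apply/idP/idP; last first.
  by apply: connect_sub => a b /= /eqP <-; apply: connect1; rewrite sE eqxx.
apply: connect_sub => a b /=; rewrite sE => /orP[/eqP->|/eqP->].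
  exact: fconnect1.
by rewrite fconnect_sym // fconnect1.
Qed.

Lemma orbit_iso_cycle x (C : {set K}) : C =i fconnect s x ->
  isomorphic (induced C) (cycle_graph (order s x)).
Proof.
move=> CE; have Cx (u : induced C) : fconnect s x (val u).
  by have := valP u; rewrite CE.
have inC (i : 'I_(order s x)) : iter i s x \in C by rewrite CE; apply: fconnect_iter.
pose f (u : induced C) : cycle_graph (order s x) := Ordinal (findex_max (Cx u)).
pose g (i : cycle_graph (order s x)) : induced C := Sub (iter i s x) (inC i).
have fK : cancel f g by move=> u; apply: val_inj; apply: iter_findex (Cx u).
have gK : cancel g f by move=> i; apply: val_inj; apply: findex_iter (ltn_ord i).
have fS (u w : induced C) : (f w == ordS (f u)) = (val w == s (val u)).
  rewrite -(inj_eq (can_inj gK)) fK -val_eqE /=; congr (_ == _).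
  have := ltn_ord (f u); rewrite leq_eqVlt => /orP[/eqP E|lt].
    rewrite E modnn /= -(iter_order s_inj x) -E iterS; congr s.
    by rewrite -[RHS]/(val u) -[in RHS](fK u).
  by rewrite modn_small // iterS (iter_findex (Cx u)).
exists f; split; first by exists g.
move=> u w; rewrite {1}/sedge /= /cycle_rel !fS -sE.
have [E|//] := eqVneq (f u) (f w); rewrite (can_inj fK E).
by rewrite [RHS]sedge_irrefl.
Qed.

Lemma edges_and_odd_cycles_orbits :
    (forall x, iter 2 s x = x \/ exists2 n, odd n & iter n s x = x) ->
    (exists x n, odd n /\ iter n s x = x) ->
  edges_and_odd_cycles K.
Proof.
move=> s_iter [x0 [n0 [odd_n0 E0]]].
have s_edge x : x -- s x by rewrite sE eqxx.
have o1 x : order s x != 1.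
  apply/eqP=> o1; have := iter_order s_inj x; rewrite o1 /= => E.
  by have := s_edge x; rewrite E sedge_irrefl.
have key x (C : {set K}) n : C =i fconnect s x -> odd n -> iter n s x = x ->
  is_odd_cycle (induced C).
  move=> CE odd_n E; exists (order s x); split; last exact: orbit_iso_cycle.
    have := order_gt0 s x; have := o1 x; have := dvdn_odd (order_dvdn s_inj E) odd_n.
    by case: (order s x) => [|[|[|]]].
  exact: dvdn_odd (order_dvdn s_inj E) odd_n.
have compE C x : C \in components K -> x \in C -> C =i fconnect s x.
  move=> Cc xC y; rewrite -[RHS]/(fconnect s x y) -connect_orbit.
  rewrite -(def_pblock (partition_trivIset (components_partition K)) Cc xC).
  by rewrite (pblock_equivalence_partition (@connect_equivalence K)) ?inE.
split=> [C Cc|].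
  have /set0Pn[x xC] := partition_neq0 (components_partition K) Cc.
  have CE := compE _ _ Cc xC.
  case: (s_iter x) => [E|[n odd_n E]]; last by right; apply: key E.
  left; have o2 : order s x = 2.
    have := dvdn_leq _ (order_dvdn s_inj E); have := o1 x; have := order_gt0 s x.
    by case: (order s x) => [|[|[|]]] // n _ _ /(_ isT).
  have [f [f_bij fe]] := orbit_iso_cycle CE; rewrite o2 in f f_bij fe.
  exists f; split=> // u w; rewrite -fe.
  by case: (f u) (f w) => [[|[|]] // ?] [[|[|]] // ?].
have x0K : x0 \in cover (components K).
  by rewrite (cover_partition (components_partition K)).
exists (pblock (components K) x0); first exact: pblock_mem.
apply: key odd_n0 E0; apply: compE; first exact: pblock_mem.
by rewrite mem_pblock.
Qed.

End OrbitCycle.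

Lemma spanning_of_odd_cover (G : sgraph) : odd_cover G ->
  exists H : subgraph G, spanning H /\ edges_and_odd_cycles H.
Proof.
case=> s [s_inj s_edge s_iter [x0 [n0 [odd_n0 E0]]]].
pose e : rel G := fun x y => (y == s x) || (x == s y).
have e_sym : symmetric e by move=> x y; rewrite /e orbC.
have eW x y : e x y -> [/\ x \in [set: G], y \in [set: G] & x -- y].
  by rewrite !inE /e => /orP[]/eqP->; split=> //; rewrite sedge_sym.
pose H := Subgraph e_sym eW; exists H; split=> //.
pose t (u : H) : H := Sub (s (val u)) (in_setT _).
have titer n u : val (iter n t u) = iter n s (val u).
  by elim: n => //= n ->.
apply: (@edges_and_odd_cycles_orbits H t).
- by move=> u w /(congr1 val) /s_inj/val_inj.
- by move=> u w; rewrite -!val_eqE.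
- move=> u; case: (s_iter (val u)) => [E|[n odd_n E]]; [left|right].
    by apply: val_inj; rewrite titer.
  by exists n => //; apply: val_inj; rewrite titer.
- exists (Sub x0 (in_setT _)), n0; split=> //.
  by apply: val_inj; rewrite titer.
Qed.

(** The permutation runs along the two cycles, and exchanges the ends of the
matching edges elsewhere: the interior [r] of the joining path is matched along
the path, the rest by hypothesis. *)
Lemma odd_cover_of_dumbbell (G : sgraph) (x1 : G) p1 x2 p2 r :
  dumbbell x1 p1 x2 p2 r -> @matchable G (~: dumbbell_set x1 p1 x2 p2 r) ->
  odd_cover G.
Proof.
case=> u cyc1 cyc2 ev1 ev2 ev pr mH.
rewrite /dumbbell_set in mH.
have od1 : odd (size (x1 :: p1)) by [].
have od2 : odd (size (x2 :: p2)) by [].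
have x1c : x1 \in x1 :: p1 by rewrite mem_head.
move: (x1 :: p1) (x2 :: p2) od1 od2 x1c u cyc1 cyc2 mH => c1 c2 od1 od2 x1c.
move=> u cyc1 cyc2 mH; move: u; rewrite !cat_uniq has_cat negb_or -andbA.
case/and5P=> u1 /hasPn d12 /hasPn d1r u2 /andP[/hasPn d2r ur].
have mr : matchable [set x in r].
  apply: matchable_sorted => //.
  by move: pr; rewrite rcons_path => /andP[/path_sorted].
have [m Hm] : @matchable G (~: [set x in c1 ++ c2]).
  have -> : ~: [set x in c1 ++ c2] = [set x in r] :|: ~: [set x in c1 ++ c2 ++ r].
    apply/setP=> x; rewrite !inE !mem_cat !negb_or.
    have := d1r x; have := d2r x.
    by case: (x \in r) => [/(_ isT)->/(_ isT)->|]; rewrite ?andbT.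
  apply: matchableU mr mH; rewrite disjoint_subset; apply/subsetP=> x.
  by rewrite !inE !mem_cat => ->; rewrite !orbT.
pose s x := if x \in c1 then next c1 x else if x \in c2 then next c2 x else m x.
have c21 x : x \in c2 -> x \in c1 = false by move=> /d12/negbTE.
have s1 x : x \in c1 -> s x = next c1 x by rewrite /s => ->.
have s2 x : x \in c2 -> s x = next c2 x by rewrite /s => xc; rewrite c21 ?xc.
have s3 x : x \notin c1 ++ c2 -> [/\ s x = m x, s x \notin c1 ++ c2,
    s (s x) = x & x -- s x].
  move=> xc; have [|+ mK me] := Hm x; first by rewrite !inE.
  rewrite !inE => mxc.
  have E y : y \notin c1 ++ c2 -> s y = m y.
    by rewrite mem_cat negb_or /s => /andP[/negbTE-> /negbTE->].
  by rewrite !E //; rewrite E.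
have cyc (c : seq G) : uniq c -> {in c, forall x, s x = next c x} ->
    {in c, forall x, iter (size c) s x = x}.
  move=> uc sc x xc.
  have sI n : iter n s x = iter n (next c) x /\ iter n s x \in c.
    elim: n => //= n [IH1 IH2]; rewrite IH1 in IH2 *.
    by rewrite sc // mem_next IH2.
  rewrite (sI _).1; rewrite -(order_cycle (cycle_next uc) uc xc).
  exact: iter_order (can_inj (prev_next uc)) x.
have sE x : [\/ x \in c1, x \in c2 | x \notin c1 ++ c2].
  rewrite mem_cat; case: (x \in c1); first by constructor 1.
  by case: (x \in c2); [constructor 2|constructor 3].
exists s; split.
(* A common exponent for all orbits makes [s] injective. *)
- have sN x : iter (2 * size c1 * size c2) s x = x.
    case: (sE x) => xc.
    + by rewrite mulnAC; apply: iter_mul_fixed; apply: cyc.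
    + by apply: iter_mul_fixed; apply: cyc.
    + by rewrite -mulnA mulnC; apply: iter_mul_fixed; case: (s3 x xc).
  have : 0 < 2 * size c1 * size c2 by rewrite !muln_gt0 (odd_gt0 od1) (odd_gt0 od2).
  case: (2 * _ * _) sN => // n sN _ x y E.
  by rewrite -(sN x) -(sN y) !iterSr E.
- move=> x; case: (sE x) => xc.
  + by rewrite s1 //; apply: next_cycle.
  + by rewrite s2 //; apply: next_cycle.
  + by case: (s3 x xc).
- move=> x; case: (sE x) => xc.
  + by right; exists (size c1) => //; apply: cyc.
  + by right; exists (size c2) => //; apply: cyc.
  + by left; case: (s3 x xc).
- by exists x1, (size c1); split=> //; apply: cyc.
Qed.

(** Here [D] is the union of the odd orbits; the other orbits are the edges of
a matching of its complement. *)
Lemma nice_dumbbell_of_odd_cover (G : sgraph) :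
  has_perfect_matching G -> odd_cover G ->
  exists (x1 : G) p1 x2 p2 r, dumbbell x1 p1 x2 p2 r /\
    @matchable G (~: dumbbell_set x1 p1 x2 p2 r).
Proof.
case/has_perfect_matchingP=> m Hm [s [s_inj s_edge s_iter [x0 [n0 [odd_n0 E0]]]]].
have mK : involutive m by move=> x; case: (Hm x (in_setT x)).
have m_edge x : x -- m x by case: (Hm x (in_setT x)).
have odS x : odd (order s x) -> odd (order s (s x)).
  by apply/dvdn_odd/order_dvdn; rewrite // -iterSr iterS iter_order.
apply: (nice_dumbbell_exists mK m_edge s_inj (D := [set x | odd (order s x)])).
- apply/set0Pn; exists x0; rewrite inE.
  exact: dvdn_odd (order_dvdn s_inj E0) odd_n0.
- by move=> x; rewrite !inE => od; rewrite od odS.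
- exists s => x; rewrite !inE => ev.
  have E : s (s x) = x.
    case: (s_iter x) => [//|[n odd_n /(order_dvdn s_inj) o_n]].
    by case/negP: ev; apply: dvdn_odd odd_n.
  by split=> //; apply: contra ev => /odS; rewrite E.
Qed.

Lemma dumbbell_val (G : sgraph) (H : subgraph G) (x1 : H) p1 x2 p2 r :
  dumbbell x1 p1 x2 p2 r ->
  @dumbbell G (val x1) (map val p1) (val x2) (map val p2) (map val r).
Proof.
have val_path (u : H) q : path (@sedge H) u q -> path (@sedge G) (val u) (map val q).
  by elim: q u => //= w q IHq u /andP[/sub_edgeP[_ _ ->] /IHq].
case=> u c1 c2 e1 e2 e p; split; rewrite ?size_map //.
- by rewrite -!map_cons -!map_cat (map_inj_uniq val_inj).
- by rewrite /= -map_rcons; apply: val_path.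
- by rewrite /= -map_rcons; apply: val_path.
- by rewrite -map_rcons; apply: val_path.
Qed.

Lemma nice_dumbbell_of_subdivision (G : sgraph) (H : subgraph G) :
  nice H -> even_subdivision T_graph H ->
  exists (x1 : G) p1 x2 p2 r, dumbbell x1 p1 x2 p2 r /\
    @matchable G (~: dumbbell_set x1 p1 x2 p2 r).
Proof.
move=> /matchable_induced mH.
case=> f [P /subdivision_dumbbell[y1 [q1 [y2 [q2 [t [db cov]]]]]]].
exists (val y1), (map val q1), (val y2), (map val q2), (map val t).
split; first exact: dumbbell_val.
suff -> : dumbbell_set (val y1) (map val q1) (val y2) (map val q2) (map val t) =
  sub_vset H by [].
apply/setP=> x; rewrite inE -!map_cons -!map_cat; apply/mapP/idP.
  by case=> u _ ->; apply: valP.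
by move=> xH; exists (Sub x xH).
Qed.

Theorem corollary1p3 (G : sgraph) (hG : has_perfect_matching G) :
  egervary G <->
  ~ exists H : subgraph G, nice H /\ even_subdivision T_graph H.
Proof.
split=> [[_ noF] [H [niceH subH]]|noT].
  have [x1 [p1 [x2 [p2 [r [db mdb]]]]]] := nice_dumbbell_of_subdivision niceH subH.
  exact/noF/spanning_of_odd_cover/(odd_cover_of_dumbbell db mdb).
split=> // -[F [spF cycF]].
have [x1 [p1 [x2 [p2 [r [db mdb]]]]]] :=
  nice_dumbbell_of_odd_cover hG (odd_cover_of_spanning spF cycF).
have [H HE subH] := dumbbell_subdivision db.
by case: noT; exists H; split=> //; apply/matchable_induced; rewrite HE.
Qed.
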